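(* Let $G=\pi_1(X_K,x_0)$ be the group of a nontrivial tame knot $K\subset S^3$ with meridian $m\in G$, let $U\le G$ be a finite-index subgroup, let $M_U\trianglelefteq U$ be its ramification subgroup, and let $\pi:U\to U/M_U$ be the quotient map. Let $Q$ be any group and let $\varphi:U\to Q$ be a homomorphism such that $\varphi(I_g(U))=\{1\}$ for every $g\in G$. Then there exists a unique homomorphism $\overline{\varphi}:U/M_U\to Q$ with $\varphi=\overline{\varphi}\circ\pi$.
   Context: $K\subset S^3$ is a nontrivial tame knot, $\nu(K)$ is a tubular neighbourhood of $K$, $X_K=S^3\setminus\operatorname{int}(\nu(K))$ is the knot exterior, $x_0\in\partial X_K$ is a basepoint, and $G=\pi_1(X_K,x_0)$. A meridian is an element of $\pi_1(\partial X_K,x_0)$ represented by a simple closed curve on the torus $\partial X_K$ bounding an embedded disk in $\nu(K)$ that meets $K$ once; $m\in G$ denotes the image of a chosen meridian under the map induced by inclusion $\partial X_K\hookrightarrow X_K$. For a finite-index subgroup $U\le G$ and $g\in G$, the meridional inertia subgroup is $I_g(U):=U\cap g\langle m\rangle g^{-1}$. The ramification subgroup $M_U$ of $U$ is the normal closure in $U$ of $\bigcup_{g\in G}I_g(U)$, i.e. the smallest normal subgroup of $U$ containing every $I_g(U)$, $g\in G$. *)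

(* Defs.v *)
From HB Require Import structures.
From mathcomp Require Import all_boot all_order all_algebra.
From mathcomp Require Import all_classical all_reals all_analysis.
From mathcomp Require Import generic_quotient wedge_sigT continuous_path ring lra.
Set Implicit Arguments.
Unset Strict Implicit.
Unset Printing Implicit Defensive.
Import Order.TTheory GRing.Theory Num.Theory.
Import numFieldNormedType.Exports.
Local Open Scope classical_set_scope.
Local Open Scope ring_scope.
Local Open Scope quotient_scope.

Lemma pair_continuous (X T U : topologicalType) (f : X -> T) (g : X -> U) :
  continuous f -> continuous g -> continuous (fun x => (f x, g x)).
Proof. by move=> cf cg x; exact: (cvg_pair (cf x) (cg x)). Qed.

Lemma comp_continuous (X T U : topologicalType) (f : X -> T) (g : T -> U) :
  continuous f -> continuous g -> continuous (g \o f).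
Proof. by move=> cf cg x; apply: continuous_comp; [exact: cf|exact: cg]. Qed.

Lemma continuous_fst (X T : topologicalType) : continuous (@fst X T).
Proof. by move=> p; exact: cvg_fst. Qed.

Lemma continuous_snd (X T : topologicalType) : continuous (@snd X T).
Proof. by move=> p; exact: cvg_snd. Qed.

Section UnitInterval.
Context (R : realType).

Definition unit_interval : Type := set_type `[0 : R, 1]%classic.
HB.instance Definition _ :=
  Topological.copy unit_interval (set_type `[0 : R, 1]%classic).

Definition clamp (t : R) : R := Num.max 0 (Num.min 1 t).

Lemma clamp_itv t : clamp t \in `[0 : R, 1]%classic.
Proof.
by apply/mem_set; rewrite /= in_itv /= /clamp le_max lexx /= ge_max ler01 ge_min lexx.
Qed.

Lemma clamp_id t : 0 <= t <= 1 -> clamp t = t.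
Proof. by move=> /andP[t0 t1]; rewrite /clamp (min_idPr t1) (max_idPr t0). Qed.

Lemma clamp_le0 t : t <= 0 -> clamp t = 0.
Proof.
by move=> t0; rewrite /clamp (min_idPr (le_trans t0 ler01)) (max_idPl t0).
Qed.

Lemma clamp_ge1 t : 1 <= t -> clamp t = 1.
Proof. by move=> t1; rewrite /clamp (min_idPl t1) (max_idPr ler01). Qed.

Lemma clamp_itv01 t : 0 <= clamp t <= 1.
Proof. by have := clamp_itv t => /set_mem; rewrite /= in_itv. Qed.

Lemma clamp_continuous : continuous clamp.
Proof.
move=> t; apply: (@continuous_max R R (cst 0) (fun t => Num.min 1 t) t).
  exact: cvg_cst.
by apply: (@continuous_min R R (cst 1) id t); [exact: cvg_cst|exact: cvg_id].
Qed.

Definition to_unit (t : R) : unit_interval := exist _ (clamp t) (clamp_itv t).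

Lemma to_unit_neq : to_unit 0 != to_unit 1.
Proof.
apply/eqP => /(congr1 set_val); rewrite set_valE /=.
by rewrite clamp_le0 // clamp_ge1 // => /esym/eqP; rewrite oner_eq0.
Qed.

HB.instance Definition _ := isBiPointed.Build unit_interval to_unit_neq.

Definition of_unit (t : unit_interval) : R := set_val t.

Lemma of_unit_itv t : 0 <= of_unit t <= 1.
Proof.
by case: t => t /= Ht; rewrite /of_unit set_valE /=; move: Ht => /set_mem; rewrite /= in_itv.
Qed.

Lemma of_unitK : cancel of_unit to_unit.
Proof.
by move=> t; apply: val_inj; rewrite /= clamp_id // of_unit_itv.
Qed.

Lemma to_unitK t : 0 <= t <= 1 -> of_unit (to_unit t) = t.
Proof. by move=> t01; rewrite /of_unit set_valE /= clamp_id. Qed.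

Lemma of_unit0 : of_unit zero = 0.
Proof. by rewrite to_unitK // lexx ler01. Qed.

Lemma of_unit1 : of_unit one = 1.
Proof. by rewrite to_unitK // lexx ler01. Qed.

Lemma to_unit_le0 t : t <= 0 -> to_unit t = zero.
Proof.
by move=> t0; apply: val_inj; rewrite /= !clamp_le0.
Qed.

Lemma to_unit_ge1 t : 1 <= t -> to_unit t = one.
Proof.
by move=> t1; apply: val_inj; rewrite /= !clamp_ge1.
Qed.

Lemma to_unit_continuous : continuous to_unit.
Proof.
by apply: continuous_comp_initial; exact: clamp_continuous.
Qed.

Lemma of_unit_continuous : continuous of_unit.
Proof. exact: initial_continuous. Qed.

End UnitInterval.

Section Homotopy.
Context (R : realType) (T : topologicalType).
Local Notation I := (unit_interval R).

Definition homotopic (x y : T) (f g : {path I from x to y in T}) : Prop :=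
  exists H : I * I -> T, [/\ continuous H,
    forall t, H (t, zero) = f t,
    forall t, H (t, one) = g t,
    forall s, H (zero, s) = x &
    forall s, H (one, s) = y].

Definition extend (x y : T) (f : {path I from x to y in T}) (t : R) : T :=
  f (to_unit t).

Arguments extend : simpl never.

Lemma extend_le0 x y (f : {path I from x to y in T}) t : t <= 0 -> extend f t = x.
Proof. by move=> t0; rewrite /extend to_unit_le0 // path_zero. Qed.

Lemma extend_ge1 x y (f : {path I from x to y in T}) t : 1 <= t -> extend f t = y.
Proof. by move=> t1; rewrite /extend to_unit_ge1 // path_one. Qed.

Lemma extend_continuous x y (f : {path I from x to y in T}) : continuous (extend f).
Proof.
move=> t; apply: (@continuous_comp _ _ _ (@to_unit R) f).
  exact: to_unit_continuous.
exact: cts_fun.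
Qed.

Lemma paste_continuous (X : topologicalType) (h : X -> R) (a : R) (f g : X -> T) :
  continuous h -> continuous f -> continuous g ->
  (forall x, h x = a -> f x = g x) ->
  continuous (fun x => if h x <= a then f x else g x).
Proof.
move=> ch cf cg fg; apply/continuous_subspace_setT.
have -> : setT = [set x | h x <= a] `|` [set x | a <= h x].
  by apply/seteqP; split=> x //= _; case: (leP (h x) a) => [|/ltW]; [left|right].
apply: withinU_continuous.
- exact: (@closed_comp _ _ h [set y | y <= a] (fun x _ => ch x) (@closed_le _ a)).
- exact: (@closed_comp _ _ h [set y | a <= y] (fun x _ => ch x) (@closed_ge _ a)).
- apply: (@subspace_eq_continuous _ _ _ f); last exact: continuous_subspaceT.
  by move=> x /set_mem /= hx; rewrite /from_subspace hx.
- apply: (@subspace_eq_continuous _ _ _ g); last exact: continuous_subspaceT.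
  move=> x /set_mem /= hx; rewrite /from_subspace; case: ifP => // hx'; apply/esym/fg.
  by apply/eqP; rewrite eq_le hx hx'.
Qed.

(* A homotopy may equivalently be given by a map defined on all of R * R. *)
Lemma homotopicP x y (f g : {path I from x to y in T}) :
  homotopic f g <-> exists K : R * R -> T, [/\ continuous K,
    forall t, 0 <= t <= 1 -> K (t, 0) = extend f t,
    forall t, 0 <= t <= 1 -> K (t, 1) = extend g t,
    forall s, 0 <= s <= 1 -> K (0, s) = x &
    forall s, 0 <= s <= 1 -> K (1, s) = y].
Proof.
split=> -[K [cK K0 K1 Kx Ky]].
  exists (fun p => K (to_unit p.1, to_unit p.2)); split => [|t _|t _|s _|s _] /=; [|exact: K0|exact: K1|exact: Kx|exact: Ky].
  have ck : continuous (fun p : R * R => (to_unit p.1, to_unit p.2)).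
    apply: pair_continuous.
      exact: (comp_continuous (@continuous_fst _ _) (@to_unit_continuous R)).
    exact: (comp_continuous (@continuous_snd _ _) (@to_unit_continuous R)).
  exact: (comp_continuous ck cK).
exists (fun p => K (of_unit p.1, of_unit p.2)); split => [|t|t|s|s] /=.
- have ck : continuous (fun p : I * I => (of_unit p.1, of_unit p.2)).
    apply: pair_continuous.
      exact: (comp_continuous (@continuous_fst _ _) (@of_unit_continuous R)).
    exact: (comp_continuous (@continuous_snd _ _) (@of_unit_continuous R)).
  exact: (comp_continuous ck cK).
- by rewrite of_unit0 K0 ?of_unit_itv // /extend of_unitK.
- by rewrite of_unit1 K1 ?of_unit_itv // /extend of_unitK.
- by rewrite of_unit0 Kx ?of_unit_itv.
- by rewrite of_unit1 Ky ?of_unit_itv.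
Qed.

End Homotopy.

Arguments extend : simpl never.

Section HomotopyEquivalence.
Context (R : realType) (T : topologicalType) (x y : T).
Local Notation I := (unit_interval R).
Local Notation P := {path I from x to y in T}.
Implicit Types f g h : P.

Lemma extend_of_unit f t : extend f (of_unit t) = f t.
Proof. by rewrite /extend of_unitK. Qed.

Lemma homotopic_extend f g (K : R * R -> R) (h : P) : continuous K ->
  (forall t, 0 <= t <= 1 -> extend h (K (t, 0)) = extend f t) ->
  (forall t, 0 <= t <= 1 -> extend h (K (t, 1)) = extend g t) ->
  (forall s, 0 <= s <= 1 -> extend h (K (0, s)) = x) ->
  (forall s, 0 <= s <= 1 -> extend h (K (1, s)) = y) ->
  homotopic f g.
Proof.
move=> cK K0 K1 Kx Ky; apply/homotopicP; exists (extend h \o K); split=> //.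
exact: (comp_continuous cK (extend_continuous (f := h))).
Qed.

Lemma homotopic_refl f : homotopic f f.
Proof.
apply: (@homotopic_extend f f fst f) => //=; first exact: continuous_fst.
  by move=> s _; rewrite extend_le0.
by move=> s _; rewrite extend_ge1.
Qed.

Lemma homotopic_sym f g : homotopic f g -> homotopic g f.
Proof.
move=> /homotopicP[K [cK K0 K1 Kx Ky]]; apply/homotopicP.
exists (K \o (fun p : R * R => (p.1, 1 - p.2))); split => /=.
- apply: comp_continuous => //; apply: pair_continuous => p; first exact: cvg_fst.
  by apply: cvgB; [exact: cvg_cst|exact: cvg_snd].
- by move=> t t01; rewrite subr0 K1.
- by move=> t t01; rewrite subrr K0.
- by move=> s s01; rewrite Kx //; lra.
- by move=> s s01; rewrite Ky //; lra.
Qed.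

Lemma homotopic_trans f g h : homotopic f g -> homotopic g h -> homotopic f h.
Proof.
move=> /homotopicP[K [cK K0 K1 Kx Ky]] /homotopicP[L [cL L0 L1 Lx Ly]].
pose M (p : R * R) := if p.2 <= 2^-1 then K (clamp p.1, 2 * p.2)
  else L (clamp p.1, 2 * p.2 - 1).
apply/homotopicP; exists M; rewrite /M; split => /=.
- have cc : continuous (fun p : R * R => clamp p.1).
    exact: (comp_continuous (@continuous_fst _ _) (@clamp_continuous R)).
  have c2 : continuous (fun p : R * R => 2 * p.2).
    by move=> p; apply: cvgM; [exact: cvg_cst|exact: cvg_snd].
  apply: (paste_continuous (h := snd)); first exact: continuous_snd.
  + exact: (comp_continuous (pair_continuous cc c2) cK).
  + have c3 : continuous (fun p : R * R => 2 * p.2 - 1).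
      by move=> p; apply: cvgB; [exact: c2|exact: cvg_cst].
    exact: (comp_continuous (pair_continuous cc c3) cL).
  + move=> [t s] /= ->; have c01 := andP (clamp_itv01 t).
    by rewrite mulfV // subrr K1 ?L0 // clamp_itv01.
- by move=> t t01; rewrite ifT ?mulr0 ?clamp_id ?K0 //; lra.
- move=> t t01; rewrite ifF; last by apply/negbTE; rewrite -ltNge; lra.
  by rewrite clamp_id // -(L1 t t01); congr (L (_, _)); lra.
- move=> s s01; rewrite clamp_id ?lexx ?ler01 //.
  by case: ifPn => s2; [apply: Kx|apply: Lx]; lra.
- move=> s s01; rewrite clamp_id ?lexx ?ler01 //.
  by case: ifPn => s2; [apply: Ky|apply: Ly]; lra.
Qed.

End HomotopyEquivalence.

Section FundamentalGroup.
Context (R : realType) (T : topologicalType) (x : T).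
Local Notation I := (unit_interval R).
Local Notation loop := {path I from x to x in T}.
Implicit Types f g h : loop.

Section LoopOf.
Context (k : R -> T) (ck : continuous k) (k0 : k 0 = x) (k1 : k 1 = x).

Let kI (t : I) : T := k (of_unit t).

Let ckI : continuous kI.
Proof. exact: (comp_continuous (@of_unit_continuous R) ck). Qed.

Let kI0 : kI zero = x.
Proof. by rewrite /kI of_unit0. Qed.

Let kI1 : kI one = x.
Proof. by rewrite /kI of_unit1. Qed.

Definition loop_of : loop := mk_path ckI kI0 kI1.

Lemma loop_ofE t : 0 <= t <= 1 -> extend loop_of t = k t.
Proof. by move=> t01; rewrite /extend /= /mk_path /kI to_unitK. Qed.

End LoopOf.

Section LoopMul.
Context (f g : loop).

Definition loop_mul_fun (t : R) : T :=
  if t <= 2^-1 then extend f (2 * t) else extend g (2 * t - 1).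

Lemma loop_mul_continuous : continuous loop_mul_fun.
Proof.
have c2 : continuous (fun t : R => 2 * t).
  by move=> p; apply: cvgM; [exact: cvg_cst|exact: cvg_id].
apply: (paste_continuous (h := idfun)).
- by move=> t; exact: cvg_id.
- exact: (comp_continuous c2 (extend_continuous (f := f))).
- have c3 : continuous (fun t : R => 2 * t - 1).
    by move=> p; apply: cvgB; [exact: c2|exact: cvg_cst].
  exact: (comp_continuous c3 (extend_continuous (f := g))).
- by move=> t /= ->; rewrite mulfV // subrr extend_ge1 // extend_le0.
Qed.

Lemma loop_mul0 : loop_mul_fun 0 = x.
Proof. by rewrite /loop_mul_fun ifT ?mulr0 ?extend_le0 //; lra. Qed.

Lemma loop_mul1 : loop_mul_fun 1 = x.
Proof.
rewrite /loop_mul_fun ifF; last by apply/negbTE; rewrite -ltNge; lra.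
by rewrite extend_ge1 //; lra.
Qed.

(* f is followed first, then g. *)
Definition loop_mul : loop := loop_of loop_mul_continuous loop_mul0 loop_mul1.

Lemma loop_mulE t : 0 <= t <= 1 -> extend loop_mul t = loop_mul_fun t.
Proof. exact: loop_ofE. Qed.

Lemma loop_mul_lo t : 0 <= t <= 2^-1 -> extend loop_mul t = extend f (2 * t).
Proof.
by move=> t01; rewrite loop_mulE /loop_mul_fun ?ifT //; lra.
Qed.

Lemma loop_mul_hi t : 2^-1 < t <= 1 -> extend loop_mul t = extend g (2 * t - 1).
Proof.
move=> t01; rewrite loop_mulE /loop_mul_fun; last lra.
by rewrite ifF //; apply/negbTE; rewrite -ltNge; lra.
Qed.

Definition loop_inv_fun (t : R) : T := extend f (1 - t).

Lemma loop_inv_continuous : continuous loop_inv_fun.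
Proof.
have c1 : continuous (fun t : R => 1 - t).
  by move=> t; apply: cvgB; [exact: cvg_cst|exact: cvg_id].
exact: (comp_continuous c1 (extend_continuous (f := f))).
Qed.

Lemma loop_inv0 : loop_inv_fun 0 = x.
Proof. by rewrite /loop_inv_fun extend_ge1 //; lra. Qed.

Lemma loop_inv1 : loop_inv_fun 1 = x.
Proof. by rewrite /loop_inv_fun extend_le0 //; lra. Qed.

Definition loop_inv : loop := loop_of loop_inv_continuous loop_inv0 loop_inv1.

Lemma loop_invE t : 0 <= t <= 1 -> extend loop_inv t = extend f (1 - t).
Proof. exact: loop_ofE. Qed.

End LoopMul.

Arguments loop_mul : simpl never.
Arguments loop_inv : simpl never.

Definition loop_one : loop := cst x.

Lemma loop_oneE t : extend loop_one t = x.
Proof. by []. Qed.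

Lemma loop_mul_homotopic f f' g g' :
  homotopic f f' -> homotopic g g' -> homotopic (loop_mul f g) (loop_mul f' g').
Proof.
move=> /homotopicP[K [cK K0 K1 Kx Ky]] /homotopicP[L [cL L0 L1 Lx Ly]].
pose M (p : R * R) := if p.1 <= 2^-1 then K (2 * p.1, clamp p.2)
  else L (2 * p.1 - 1, clamp p.2).
apply/homotopicP; exists M; rewrite /M; split => /=.
- have cc : continuous (fun p : R * R => clamp p.2).
    exact: (comp_continuous (@continuous_snd _ _) (@clamp_continuous R)).
  have c2 : continuous (fun p : R * R => 2 * p.1).
    by move=> p; apply: cvgM; [exact: cvg_cst|exact: cvg_fst].
  apply: (paste_continuous (h := fst)); first exact: continuous_fst.
  + exact: (comp_continuous (pair_continuous c2 cc) cK).
  + have c3 : continuous (fun p : R * R => 2 * p.1 - 1).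
      by move=> p; apply: cvgB; [exact: c2|exact: cvg_cst].
    exact: (comp_continuous (pair_continuous c3 cc) cL).
  + move=> [t s] /= ->.
    by rewrite mulfV // subrr Ky ?Lx // clamp_itv01.
- move=> t t01; rewrite loop_mulE // /loop_mul_fun clamp_id ?lexx ?ler01 //.
  by case: ifPn => t2; [apply: K0|apply: L0]; lra.
- move=> t t01; rewrite loop_mulE // /loop_mul_fun clamp_id ?lexx ?ler01 //.
  by case: ifPn => t2; [apply: K1|apply: L1]; lra.
- by move=> s s01; rewrite ifT ?mulr0 ?Kx ?clamp_itv01 //; lra.
- move=> s s01; rewrite ifF; last by apply/negbTE; rewrite -ltNge; lra.
  by rewrite (_ : 2 * 1 - 1 = 1) ?Ly ?clamp_itv01 //; lra.
Qed.

Lemma loop_inv_homotopic f f' :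
  homotopic f f' -> homotopic (loop_inv f) (loop_inv f').
Proof.
move=> /homotopicP[K [cK K0 K1 Kx Ky]]; apply/homotopicP.
exists (K \o (fun p : R * R => (1 - p.1, p.2))); split => /=.
- apply: comp_continuous => //; apply: pair_continuous => p; last exact: cvg_snd.
  by apply: cvgB; [exact: cvg_cst|exact: cvg_fst].
- by move=> t t01; rewrite loop_invE ?K0 //; lra.
- by move=> t t01; rewrite loop_invE ?K1 //; lra.
- by move=> s s01; rewrite subr0 Ky.
- by move=> s s01; rewrite subrr Kx.
Qed.

Lemma affine_homotopy (u v : R -> R) : continuous u -> continuous v ->
  continuous (fun p : R * R => (1 - p.2) * u p.1 + p.2 * v p.1).
Proof.
move=> cu cv p; apply: cvgD; apply: cvgM.
- by apply: cvgB; [exact: cvg_cst|exact: cvg_snd].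
- exact: (comp_continuous (@continuous_fst _ _) cu).
- exact: cvg_snd.
- exact: (comp_continuous (@continuous_fst _ _) cv).
Qed.

Lemma loop_mulA f g h :
  homotopic (loop_mul f (loop_mul g h)) (loop_mul (loop_mul f g) h).
Proof.
pose u (t : R) := Num.min (2 * t) (Num.min (t + 4^-1) (t / 2 + 2^-1)).
have cu : continuous u.
  move=> t; apply: (@continuous_min R R); last apply: (@continuous_min R R).
  - by apply: cvgM; [exact: cvg_cst|exact: cvg_id].
  - by apply: cvgD; [exact: cvg_id|exact: cvg_cst].
  - by apply: cvgD; [apply: cvgM; [exact: cvg_id|exact: cvg_cst]|exact: cvg_cst].
apply: (homotopic_extend (h := loop_mul f (loop_mul g h))
  (affine_homotopy (u := idfun) _ cu)) => /=.
- by move=> t; exact: cvg_id.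
- by move=> t t01; congr extend; lra.
- move=> t t01; rewrite subrr mul0r add0r mul1r.
  have [t2|t2] := leP t 2^-1.
    rewrite [RHS]loop_mul_lo; last lra.
    have [t4|t4] := leP t 4^-1.
      have -> : u t = 2 * t by rewrite /u (min_idPl _) // le_min; lra.
      by rewrite !loop_mul_lo //; lra.
    have -> : u t = t + 4^-1.
      by rewrite /u (min_idPr _) ?ge_min ?(min_idPl _) //; lra.
    rewrite loop_mul_hi; last lra.
    rewrite loop_mul_lo; last lra.
    by rewrite loop_mul_hi; [congr extend|]; lra.
  have -> : u t = t / 2 + 2^-1.
    by rewrite /u !(min_idPr _) ?ge_min //; lra.
  rewrite loop_mul_hi; last lra.
  rewrite loop_mul_hi; last lra.
  by rewrite loop_mul_hi; [congr extend|]; lra.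
- move=> s s01; rewrite extend_le0 // /u (min_idPl _) ?le_min; lra.
- by move=> s s01; rewrite extend_ge1 // /u; rewrite !(min_idPr _) ?ge_min; lra.
Qed.

Lemma loop_mul1l f : homotopic (loop_mul loop_one f) f.
Proof.
apply: (homotopic_extend (h := f)
  (affine_homotopy (u := fun t => 2 * t - 1) (v := idfun) _ _)) => /=.
- by move=> t; apply: cvgB; [apply: cvgM; [exact: cvg_cst|exact: cvg_id]|exact: cvg_cst].
- by move=> t; exact: cvg_id.
- move=> t t01; rewrite loop_mulE // /loop_mul_fun.
  case: ifPn => t2; last by congr extend; lra.
  by rewrite loop_oneE extend_le0 //; lra.
- by move=> t t01; congr extend; lra.
- by move=> s s01; rewrite extend_le0 //; lra.
- by move=> s s01; rewrite extend_ge1 //; lra.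
Qed.

Lemma loop_mul1r f : homotopic (loop_mul f loop_one) f.
Proof.
apply: (homotopic_extend (h := f)
  (affine_homotopy (u := fun t => 2 * t) (v := idfun) _ _)) => /=.
- by move=> t; apply: cvgM; [exact: cvg_cst|exact: cvg_id].
- by move=> t; exact: cvg_id.
- move=> t t01; rewrite loop_mulE // /loop_mul_fun.
  case: ifPn => t2; first by congr extend; lra.
  by rewrite loop_oneE extend_ge1 //; lra.
- by move=> t t01; congr extend; lra.
- by move=> s s01; rewrite extend_le0 //; lra.
- by move=> s s01; rewrite extend_ge1 //; lra.
Qed.

Lemma loop_mulVl f : homotopic (loop_mul (loop_inv f) f) loop_one.
Proof.
have cK : continuous (fun p : R * R => Num.max `|2 * p.1 - 1| p.2).
  move=> p; apply: (@continuous_max R (R * R)%type); last exact: cvg_snd.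
  apply: cvg_norm; apply: cvgB; last exact: cvg_cst.
  by apply: cvgM; [exact: cvg_cst|exact: cvg_fst].
apply: (homotopic_extend (h := f) cK) => /=.
- move=> t t01; rewrite (max_idPl _) // loop_mulE // /loop_mul_fun.
  case: ifPn => t2.
    rewrite loop_invE; last lra.
    by rewrite ler0_norm; [congr extend|]; lra.
  by rewrite ger0_norm //; lra.
- by move=> t t01; rewrite extend_ge1 // le_max lexx orbT.
- by move=> s s01; rewrite extend_ge1 // le_max mulr0 sub0r normrN normr1 lexx.
- move=> s s01; rewrite extend_ge1 // le_max (_ : 2 * 1 - 1 = 1) ?normr1 ?lexx //.
  by lra.
Qed.

Lemma loop_mulVr f : homotopic (loop_mul f (loop_inv f)) loop_one.
Proof.
have cK : continuous (fun p : R * R => Num.min (1 - `|2 * p.1 - 1|) (1 - p.2)).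
  move=> p; apply: (@continuous_min R (R * R)%type).
    apply: cvgB; first exact: cvg_cst.
    apply: cvg_norm; apply: cvgB; last exact: cvg_cst.
    by apply: cvgM; [exact: cvg_cst|exact: cvg_fst].
  by apply: cvgB; [exact: cvg_cst|exact: cvg_snd].
apply: (homotopic_extend (h := f) cK) => /=.
- move=> t t01; rewrite (min_idPl _); last by rewrite subr0 gerBl.
  rewrite loop_mulE // /loop_mul_fun; case: ifPn => t2.
    by rewrite ler0_norm; [congr extend|]; lra.
  rewrite loop_invE; last lra.
  by rewrite ger0_norm; [congr extend|]; lra.
- by move=> t t01; rewrite extend_le0 // ge_min subrr lexx orbT.
- by move=> s s01; rewrite extend_le0 // ge_min mulr0 sub0r normrN normr1 subrr lexx.
- move=> s s01; rewrite extend_le0 // ge_min (_ : 2 * 1 - 1 = 1) ?normr1 ?subrr ?lexx //.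
  by lra.
Qed.

Definition homotopicb : rel loop := fun f g => `[< homotopic f g >].

Lemma homotopicb_refl : reflexive homotopicb.
Proof. by move=> f; apply/asboolP; exact: homotopic_refl. Qed.

Lemma homotopicb_sym : symmetric homotopicb.
Proof.
by move=> f g; apply/idP/idP => /asboolP fg; apply/asboolP; exact: homotopic_sym.
Qed.

Lemma homotopicb_trans : transitive homotopicb.
Proof.
move=> g f h /asboolP fg /asboolP gh; apply/asboolP.
exact: homotopic_trans fg gh.
Qed.

Canonical homotopicb_equiv :=
  EquivRel homotopicb homotopicb_refl homotopicb_sym homotopicb_trans.

Definition pi1 : Type := {eq_quot homotopicb}.
HB.instance Definition _ := EqQuotient.on pi1.
HB.instance Definition _ := Choice.on pi1.

Definition pi1_class (f : loop) : pi1 := \pi_pi1 f.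

Lemma pi1_classP f g : pi1_class f = pi1_class g <-> homotopic f g.
Proof.
split=> [/eqmodP /asboolP //|fg].
by apply/eqmodP/asboolP.
Qed.

Lemma pi1_ind (P : pi1 -> Prop) : (forall f, P (pi1_class f)) -> forall a, P a.
Proof. by move=> Pf a; rewrite -[a]reprK; exact: Pf. Qed.

Lemma homotopic_repr f : homotopic (repr (pi1_class f)) f.
Proof. by apply/pi1_classP; rewrite /pi1_class reprK. Qed.

Definition pi1_mul (a b : pi1) : pi1 := pi1_class (loop_mul (repr a) (repr b)).
Definition pi1_inv (a : pi1) : pi1 := pi1_class (loop_inv (repr a)).
Definition pi1_one : pi1 := pi1_class loop_one.

Lemma pi1_mulE f g : pi1_mul (pi1_class f) (pi1_class g) = pi1_class (loop_mul f g).
Proof. by apply/pi1_classP/loop_mul_homotopic; exact: homotopic_repr. Qed.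

Lemma pi1_invE f : pi1_inv (pi1_class f) = pi1_class (loop_inv f).
Proof. by apply/pi1_classP/loop_inv_homotopic; exact: homotopic_repr. Qed.

Lemma pi1_mulA : associative pi1_mul.
Proof.
elim/pi1_ind => f; elim/pi1_ind => g; elim/pi1_ind => h.
by rewrite !pi1_mulE; apply/pi1_classP; exact: loop_mulA.
Qed.

Lemma pi1_mul1l : left_id pi1_one pi1_mul.
Proof. by elim/pi1_ind => f; rewrite pi1_mulE; apply/pi1_classP/loop_mul1l. Qed.

Lemma pi1_mul1r : right_id pi1_one pi1_mul.
Proof. by elim/pi1_ind => f; rewrite pi1_mulE; apply/pi1_classP/loop_mul1r. Qed.

Lemma pi1_mulVl : left_inverse pi1_one pi1_inv pi1_mul.
Proof.
by elim/pi1_ind => f; rewrite pi1_invE pi1_mulE; apply/pi1_classP/loop_mulVl.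
Qed.

Lemma pi1_mulVr : right_inverse pi1_one pi1_inv pi1_mul.
Proof.
by elim/pi1_ind => f; rewrite pi1_invE pi1_mulE; apply/pi1_classP/loop_mulVr.
Qed.

HB.instance Definition _ := isGroup.Build pi1
  pi1_mulA pi1_mul1l pi1_mul1r pi1_mulVl pi1_mulVr.

End FundamentalGroup.

Section FundamentalGroupMap.
Context (R : realType) (T U : topologicalType) (f : continuousType T U) (x : T).

Definition pi1_map (a : pi1 R x) : pi1 R (f x) := pi1_class (f \o repr a).

Lemma pi1_mapE (p : {path (unit_interval R) from x to x in T}) :
  pi1_map (pi1_class p) = pi1_class (f \o p).
Proof.
apply/pi1_classP; case: (homotopic_repr p) => H [cH H0 H1 Hx Hy].
exists (f \o H); split=> [|t|t|s|s] /=.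
- exact: (comp_continuous cH (@cts_fun _ _ f)).
- by rewrite H0.
- by rewrite H1.
- by rewrite Hx.
- by rewrite Hy.
Qed.

Lemma pi1_map_mul : {morph pi1_map : a b / (a * b)%g}.
Proof.
elim/pi1_ind => p; elim/pi1_ind => q.
rewrite [X in pi1_map X]pi1_mulE !pi1_mapE [RHS]pi1_mulE.
congr (pi1_class _); apply/path_eqP => t /=.
by rewrite /mk_path /= /loop_mul_fun; case: ifP.
Qed.

HB.instance Definition _ := isMultiplicative.Build _ _ pi1_map pi1_map_mul.

End FundamentalGroupMap.

Section Inclusion.
Context (X : topologicalType) (A B : set X) (AB : A `<=` B).

Definition inclusion (a : A) : B :=
  exist _ (set_val a) (mem_set (AB (set_valP a))).

Lemma inclusion_continuous : continuous inclusion.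
Proof. by apply: continuous_comp_initial; exact: initial_continuous. Qed.

HB.instance Definition _ := isContinuous.Build A B inclusion inclusion_continuous.

End Inclusion.

Section Groups.
Local Open Scope group_scope.

Definition normal_subgroup_set (H : groupType) (A : set H) : Prop :=
  group_closed (mem A) /\ forall a h : H, A a -> A (a ^ h).

Record normalSubgroup (H : groupType) := NormalSubgroup {
  normal_set : set H;
  normal_setP : normal_subgroup_set normal_set
}.

Lemma smallest_normal_subgroup (H : groupType) (S : set H) :
  normal_subgroup_set (smallest (@normal_subgroup_set H) S).
Proof.
split; first split.
- by apply/mem_set => A [[[/set_mem A1 _] _] _].
- move=> a b /set_mem Sa /set_mem Sb; apply/mem_set => A AS.
  have [[[_ AD] _] _] := AS; apply/set_mem.
  exact: (AD a b (mem_set (Sa A AS)) (mem_set (Sb A AS))).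
- by move=> a h Sa A AS; have [[_ AJ] _] := AS; exact: (AJ _ _ (Sa A AS)).
Qed.

Definition normal_closure (H : groupType) (S : set H) : normalSubgroup H :=
  NormalSubgroup (smallest_normal_subgroup S).

Section Quotient.
Context (H : groupType) (N : normalSubgroup H).

Lemma normal1 : normal_set N 1.
Proof. by have [[/set_mem]] := normal_setP N. Qed.

Lemma normalF a b : normal_set N a -> normal_set N b -> normal_set N (a / b).
Proof.
have [[_ ND] _] := normal_setP N.
by move=> Na Nb; exact: (set_mem (ND a b (mem_set Na) (mem_set Nb))).
Qed.

Lemma normalV a : normal_set N a -> normal_set N a^-1.
Proof. by move=> Na; rewrite -[_^-1]mul1g; apply: normalF => //; exact: normal1. Qed.

Lemma normalM a b : normal_set N a -> normal_set N b -> normal_set N (a * b).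
Proof. by move=> Na Nb; rewrite -[b]invgK; apply: normalF => //; exact: normalV. Qed.

Lemma normalJ a h : normal_set N a -> normal_set N (a ^ h).
Proof. by have [_] := normal_setP N; apply. Qed.

Definition coset_eq : rel H := fun a b => `[< normal_set N (a^-1 * b) >].

Lemma coset_eq_refl : reflexive coset_eq.
Proof. by move=> a; apply/asboolP; rewrite mulVg; exact: normal1. Qed.

Lemma coset_eq_sym : symmetric coset_eq.
Proof.
by move=> a b; apply/idP/idP => /asboolP /normalV; rewrite invgM invgK => ?;
  apply/asboolP.
Qed.

Lemma coset_eq_trans : transitive coset_eq.
Proof.
move=> b a c /asboolP ab /asboolP bc; apply/asboolP.
by have := normalM ab bc; rewrite mulgA mulgK.
Qed.

Canonical coset_equiv :=
  EquivRel coset_eq coset_eq_refl coset_eq_sym coset_eq_trans.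

Definition quotient_group : Type := {eq_quot coset_eq}.
HB.instance Definition _ := EqQuotient.on quotient_group.
HB.instance Definition _ := Choice.on quotient_group.

Definition quotient_map (a : H) : quotient_group := \pi_quotient_group a.

Lemma quotient_mapP a b : quotient_map a = quotient_map b <-> normal_set N (a^-1 * b).
Proof.
split=> [/eqmodP /asboolP //|ab].
by apply/eqmodP/asboolP.
Qed.

Lemma quotient_ind (P : quotient_group -> Prop) :
  (forall a, P (quotient_map a)) -> forall c, P c.
Proof. by move=> Pa c; rewrite -[c]reprK; exact: Pa. Qed.

Lemma repr_quotient a : normal_set N ((repr (quotient_map a))^-1 * a).
Proof. by apply/quotient_mapP; rewrite /quotient_map reprK. Qed.

Definition quotient_mul (c d : quotient_group) := quotient_map (repr c * repr d).
Definition quotient_inv (c : quotient_group) := quotient_map (repr c)^-1.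

Lemma quotient_mulE a b :
  quotient_mul (quotient_map a) (quotient_map b) = quotient_map (a * b).
Proof.
apply/quotient_mapP; set c := repr _; set d := repr _.
have Na : normal_set N (c^-1 * a) by exact: repr_quotient.
have Nb : normal_set N (d^-1 * b) by exact: repr_quotient.
have -> : (c * d)^-1 * (a * b) = ((c^-1 * a) ^ d) * (d^-1 * b).
  by rewrite /conjg invgM !mulgA mulgK.
by apply: normalM => //; exact: normalJ.
Qed.

Lemma quotient_invE a : quotient_inv (quotient_map a) = quotient_map a^-1.
Proof.
apply/quotient_mapP; set c := repr _.
have Na : normal_set N (c^-1 * a) by exact: repr_quotient.
have -> : c^-1^-1 * a^-1 = ((c^-1 * a) ^ c^-1)^-1.
  by rewrite /conjg !invgM !invgK !mulgA mulgK.
exact/normalV/normalJ.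
Qed.

Lemma quotient_mulA : associative quotient_mul.
Proof.
elim/quotient_ind => a; elim/quotient_ind => b; elim/quotient_ind => c.
by rewrite !quotient_mulE mulgA.
Qed.

Lemma quotient_mul1l : left_id (quotient_map 1) quotient_mul.
Proof. by elim/quotient_ind => a; rewrite quotient_mulE mul1g. Qed.

Lemma quotient_mul1r : right_id (quotient_map 1) quotient_mul.
Proof. by elim/quotient_ind => a; rewrite quotient_mulE mulg1. Qed.

Lemma quotient_mulVl : left_inverse (quotient_map 1) quotient_inv quotient_mul.
Proof. by elim/quotient_ind => a; rewrite quotient_invE quotient_mulE mulVg. Qed.

Lemma quotient_mulVr : right_inverse (quotient_map 1) quotient_inv quotient_mul.
Proof. by elim/quotient_ind => a; rewrite quotient_invE quotient_mulE mulgV. Qed.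

HB.instance Definition _ := isGroup.Build quotient_group
  quotient_mulA quotient_mul1l quotient_mul1r quotient_mulVl quotient_mulVr.

Lemma quotient_map_mul : {morph quotient_map : a b / a * b}.
Proof. by move=> a b; rewrite [RHS]quotient_mulE. Qed.

HB.instance Definition _ :=
  isMultiplicative.Build H quotient_group quotient_map quotient_map_mul.

End Quotient.

Section Subgroup.
Context (G : groupType) (U : groupClosed G).

Definition subgroup : Type := {g : G | g \in U}.
HB.instance Definition _ := SubChoice.on subgroup.

Lemma subgroup_closed : group_closed U.
Proof.
by split=> [|a b Ua Ub]; [exact: gpred1|apply: gpredM => //; exact: gpredVr].
Qed.

HB.instance Definition _ :=
  SubChoice_isSubGroup.Build G (fun g => g \in U) subgroup subgroup_closed.

Definition finite_index : Prop :=
  finite_set (range (fun g : G => [set g * u | u in [set` U]])).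

Definition cyclic_subgroup (m : G) : set G :=
  range (fun n : nat => m ^+ n) `|` range (fun n : nat => m ^- n).

Definition inertia (m g : G) : set G :=
  [set` U] `&` [set g * c * g^-1 | c in cyclic_subgroup m].

(* The same set, seen inside the group U itself. *)
Definition inertia_in (m g : G) : set subgroup := \val @^-1` inertia m g.

Definition ramification (m : G) : normalSubgroup subgroup :=
  normal_closure (\bigcup_g inertia_in m g).

End Subgroup.


End Groups.

Arguments inertia_in {G} U (m g)%_group_scope _.

Section TopologicalMaps.
Context (X Y : topologicalType).

Definition embedding (f : X -> Y) : Prop :=
  injective f /\
  forall A : set X, open A <-> exists2 B : set Y, open B & A = f @^-1` B.

Definition homeomorphism (f : X -> Y) : Prop :=
  continuous f /\ exists g : Y -> X, [/\ continuous g, cancel f g & cancel g f].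

End TopologicalMaps.

Definition boundary (X : topologicalType) (A : set X) : set X :=
  closure A `\` A°.

Section Euclidean.
Context (R : realType).

(* The library norm on 'rV[R]_n is the sup norm. *)
Definition sqnorm n (x : 'rV[R]_n) : R := \sum_(i < n) x ord0 i ^+ 2.

Definition unit_sphere n : set 'rV[R]_n := [set x | sqnorm x = 1].

Definition unit_disk : set 'rV[R]_2 := [set x | sqnorm x <= 1].

Definition segment n (a b : 'rV[R]_n) : set 'rV[R]_n :=
  [set (1 - t) *: a + t *: b | t in `[0, 1]%classic].

Definition circle : Type := set_type (@unit_sphere 2).
HB.instance Definition _ := Topological.copy circle (set_type (@unit_sphere 2)).

Definition S3 : Type := set_type (@unit_sphere 4).
HB.instance Definition _ := Topological.copy S3 (set_type (@unit_sphere 4)).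

Definition S3_coord (x : S3) (i : nat) : R := \val x ord0 (inord i).

Definition S3_pole : set S3 := [set x | S3_coord x 3 = 1].

Definition stereographic (x : S3) : 'rV[R]_3 :=
  \row_(i < 3) (S3_coord x i / (1 - S3_coord x 3)).

Definition is_knot (K : set S3) : Prop :=
  exists f : circle -> S3, embedding f /\ K = range f.

Definition polygonal (K : set S3) : Prop :=
  K `&` S3_pole = set0 /\
  exists s : seq ('rV[R]_3 * 'rV[R]_3),
    stereographic @` K = \bigcup_(ab in [set` s]) segment ab.1 ab.2.

(* K is equivalent, by a homeomorphism of S3, to a polygonal knot of R^3. *)
Definition tame_knot (K : set S3) : Prop :=
  is_knot K /\ exists h : S3 -> S3, homeomorphism h /\ polygonal (h @` K).

Definition unknot : set S3 := [set x | S3_coord x 2 = 0 /\ S3_coord x 3 = 0].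

Definition trivial_knot (K : set S3) : Prop :=
  exists h : S3 -> S3, homeomorphism h /\ h @` K = unknot.

(* The solid torus nu is the unit disk bundle of an open tube around K; an
   embedding of the closed solid torus alone could have a wild boundary. *)
Definition tubular_neighbourhood (K nu : set S3) : Prop :=
  exists e : circle * 'rV[R]_2 -> S3,
    [/\ embedding e, K = e @` (setT `*` [set 0]) & nu = e @` (setT `*` unit_disk)].

Definition exterior (nu : set S3) : set S3 := ~` nu°.

Lemma boundary_exterior_sub nu : boundary (exterior nu) `<=` exterior nu.
Proof.
have cE : closed (exterior nu) by rewrite closedC; exact: open_interior.
by move=> x [/cE].
Qed.

Definition knot_torus (nu : set S3) : set S3 := boundary (exterior nu).

Definition torus_inclusion (nu : set S3) :
  continuousType (knot_torus nu) (exterior nu) :=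
  inclusion (@boundary_exterior_sub nu).

(* Basepoints are taken on the boundary torus. *)
Definition knot_group (nu : set S3) (x0 : knot_torus nu) : groupType :=
  pi1 R (torus_inclusion nu x0).

Definition peripheral_map (nu : set S3) (x0 : knot_torus nu) :
  pi1 R x0 -> knot_group x0 := pi1_map (torus_inclusion nu) (x := x0).

Definition simple_closed (T : topologicalType) (x : T)
    (c : {path (unit_interval R) from x to x in T}) : Prop :=
  forall s t, c s = c t ->
    [\/ s = t, s = zero /\ t = one | s = one /\ t = zero].

(* Near p, the pair (K, D) looks like the axis and the plane in R^2 * R. *)
Definition transverse_at (K D : set S3) (p : S3) : Prop :=
  exists c : 'rV[R]_2 * R -> S3,
    [/\ embedding c, open (range c), c (0, 0) = p,
        K `&` range c = c @` ([set 0] `*` setT) &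
        D `&` range c = c @` (setT `*` [set 0])].

(* "Meets K once" is a single transverse intersection point. *)
Definition is_meridian (K nu : set S3) (x0 : knot_torus nu) (mu : pi1 R x0) :
    Prop :=
  exists2 c : {path (unit_interval R) from x0 to x0 in knot_torus nu},
    mu = pi1_class c /\ simple_closed c &
    exists d : set_type unit_disk -> S3,
      [/\ embedding d, range d `<=` nu,
          [set d z | z in [set z | @unit_sphere 2 (\val z)]]
            = [set \val (c t) | t in setT] &
          exists p, K `&` range d = [set p] /\ transverse_at K (range d) p].

End Euclidean.

(* Main.v *)
Require Import Defs.
From HB Require Import structures.
From mathcomp Require Import all_boot all_order all_algebra.
From mathcomp Require Import all_classical all_reals all_analysis.
Set Implicit Arguments.
Unset Strict Implicit.
Unset Printing Implicit Defensive.
Local Open Scope classical_set_scope.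

(** The kernel of [phi] is a normal subgroup of [U] and contains every inertia
subgroup.  The ramification subgroup is the smallest normal subgroup with that
property, so it lies in the kernel ([normal_closure_sub_kernel]).  Hence [phi]
is constant on its cosets and induces a homomorphism on the quotient, which is
the only possible one because the quotient map is surjective
([quotient_group_universal]). *)

(** The morphism structure on a function is a proof, hence unique: this turns
uniqueness of the induced homomorphism, an equality of bundled morphisms, into
a pointwise statement. *)
Lemma multiplicative_ext (G H : groupType) (f g : {multiplicative G -> H}) :
  f =1 g -> f = g.
Proof.
case: f g => [f [[fM]]] [g [[gM]]] /= /funext fg.
by case: _ / fg gM => gM; rewrite (Prop_irrelevance fM gM).
Qed.

Section QuotientUniversalProperty.
Local Open Scope group_scope.
Variables (H Q : groupType) (phi : {multiplicative H -> Q}).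

(** [{multiplicative H -> Q}] records only compatibility with products; between
groups, preservation of the unit and of inverses follows by cancellation. *)
Lemma multiplicative1 : phi 1 = 1.
Proof. by apply: (mulgI (phi 1)); rewrite -gmulfM !mulg1. Qed.

Lemma multiplicativeV a : phi a^-1 = (phi a)^-1.
Proof.
by apply: (mulgI (phi a)); rewrite -gmulfM !mulgV multiplicative1.
Qed.

Lemma kernel_normal : normal_subgroup_set (phi @^-1` [set 1]).
Proof.
split=> [|a h /= pa]; last by rewrite /= /conjg !gmulfM multiplicativeV pa mul1g mulVg.
split=> [|a b /set_mem /= pa /set_mem /= pb]; apply/mem_set => /=.
  exact: multiplicative1.
by rewrite gmulfM multiplicativeV pa pb mulgV.
Qed.

Lemma normal_closure_sub_kernel (S : set H) :
  S `<=` phi @^-1` [set 1] ->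
  normal_set (normal_closure S) `<=` phi @^-1` [set 1].
Proof. by move=> Sker; apply: smallest_sub; first exact: kernel_normal. Qed.

Variable N : normalSubgroup H.

(** Stated for every [N] through a chosen representative of the coset; it
induces [phi] on the quotient once [N] lies in the kernel of [phi], since the
representative then no longer matters. *)
Definition quotient_lift (c : quotient_group N) : Q := phi (repr c).

Hypothesis N_ker : normal_set N `<=` phi @^-1` [set 1].

Lemma quotient_liftE a : quotient_lift (quotient_map N a) = phi a.
Proof.
apply: (mulgI (phi (repr (quotient_map N a)))^-1).
rewrite mulVg -multiplicativeV -gmulfM.
exact/esym/N_ker/repr_quotient.
Qed.

Lemma quotient_lift_mul : {morph quotient_lift : c d / c * d}.
Proof.
elim/quotient_ind => a; elim/quotient_ind => b.
by rewrite -gmulfM !quotient_liftE gmulfM.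
Qed.

Lemma quotient_group_universal :
  exists! phibar : {multiplicative quotient_group N -> Q},
    phi =1 phibar \o quotient_map N.
Proof.
pose lift : {multiplicative quotient_group N -> Q} := HB.pack quotient_lift
  (isMultiplicative.Build _ _ quotient_lift quotient_lift_mul).
exists lift; split=> [a|psi psiE]; first by rewrite /= quotient_liftE.
apply: multiplicative_ext; elim/quotient_ind => a.
by rewrite /= quotient_liftE psiE.
Qed.

End QuotientUniversalProperty.

Theorem theorem3p1 (R : realType) (K nu : set (S3 R))
    (K_tame : tame_knot K) (K_nontrivial : ~ trivial_knot K)
    (nu_tube : tubular_neighbourhood K nu)
    (x0 : knot_torus nu) (mu : pi1 R x0) (mu_meridian : is_meridian K mu)
    (U : groupClosed (knot_group x0)) (U_finite_index : finite_index U)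
    (Q : groupType) (phi : {multiplicative subgroup U -> Q})
    (phi_inertia : forall g : knot_group x0,
      phi @` inertia_in U (peripheral_map mu) g = [set 1%g]) :
  exists! phibar :
      {multiplicative quotient_group (ramification U (peripheral_map mu)) -> Q},
    phi =1 phibar \o quotient_map (ramification U (peripheral_map mu)).
Proof.
apply/quotient_group_universal/normal_closure_sub_kernel => a [g _ ag].
by rewrite -(phi_inertia g); exists a.
Qed.
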